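(* Let $n\ge 3$ and $k>1$, and let $\beta: M_kVB_n \to \mathrm{GL}_n(\mathbb{C})$ be a complex homogeneous $2$-local representation of $M_kVB_n$. Then $\beta$ is equivalent to one of the following $2^{k+1}+1$ distinct (types of) representations. One is the trivial representation, sending each generator to the identity matrix. The remaining $2^{k+1}$ are of the form $$\beta(\sigma_i)=E_i(S),\qquad \beta(\rho_i^{\alpha})=E_i(X_\alpha)\qquad (1\le i\le n-1,\ 0\le\alpha\le k-1),$$ where $$S\in\left\{\begin{pmatrix}1&0\\0&1\end{pmatrix},\ \begin{pmatrix}1-bc&b\\c&0\end{pmatrix},\ \begin{pmatrix}0&b\\c&0\end{pmatrix},\ \begin{pmatrix}0&-\frac{d-1}{c}\\c&d\end{pmatrix}\right\}$$ with $b,c,d\in\mathbb{C}$ such that $bc\neq 0$ (in the second and third forms), and $c\ne 0$, $d\neq 1$ (in the fourth form); $$X_\alpha\in\left\{\begin{pmatrix}0&x_\alpha\\ \frac1{x_\alpha}&0\end{pmatrix},\ \begin{pmatrix}1&0\\0&1\end{pmatrix}\right\}\quad\text{for }1\le\alpha\le k-1,\ \text{with } x_\alpha\in\mathbb{C},\ x_\alpha\ne 0;$$ and $$X_0=\begin{pmatrix}0&x_0\\ \frac1{x_0}&0\end{pmatrix}\quad\text{with } x_0\in\mathbb{C},\ x_0\neq 0.$$ (Each choice of one of the four forms for $S$ and, for each $1\le\alpha\le k-1$, one of the two forms for $X_\alpha$, gives one type.)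
   Context: For $n\ge2$, $k>1$, the multi-virtual braid group $M_kVB_n$ is the group generated by $\sigma_1,\dots,\sigma_{n-1}$ and $\rho_1^{\alpha},\dots,\rho_{n-1}^{\alpha}$ for $\alpha=0,1,\dots,k-1$ (here $\alpha$ is a superscript index, not a power), subject to the relations: - $\sigma_i\sigma_{i+1}\sigma_i=\sigma_{i+1}\sigma_i\sigma_{i+1}$ for $1\le i\le n-2$; - $\sigma_i\sigma_j=\sigma_j\sigma_i$ for $|i-j|\ge2$; - $(\rho_i^\alpha)^2=e$ for $1\le i\le n-1$ and all $\alpha$; - $\rho_i^\alpha\rho_j^\alpha=\rho_j^\alpha\rho_i^\alpha$ for $|i-j|\ge2$ and all $\alpha$; - $\rho_i^\alpha\rho_{i+1}^\alpha\rho_i^\alpha=\rho_{i+1}^\alpha\rho_i^\alpha\rho_{i+1}^\alpha$ for $1\le i\le n-2$ and all $\alpha$; - $\sigma_i\rho_j^\alpha=\rho_j^\alpha\sigma_i$ for $|i-j|\ge2$ and all $\alpha$; - $\rho_i^\alpha\rho_j^\beta=\rho_j^\beta\rho_i^\alpha$ for $|i-j|\ge2$ and $\alpha\ne\beta$; - $\sigma_i\rho_{i+1}^0\rho_i^0=\rho_{i+1}^0\rho_i^0\sigma_{i+1}$ for $1\le i\le n-2$; - $\rho_i^0\rho_{i+1}^0\rho_i^\beta=\rho_{i+1}^\beta\rho_i^0\rho_{i+1}^0$ for $1\le i\le n-2$ and $1\le\beta\le k-1$. For a $2\times2$ matrix $M$ and $1\le i\le n-1$, $E_i(M)$ denotes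 the $n\times n$ block diagonal matrix $\mathrm{diag}(I_{i-1},M,I_{n-i-1})$, where $I_r$ is the $r\times r$ identity matrix. A complex homogeneous $2$-local representation of $M_kVB_n$ is a group homomorphism $\beta:M_kVB_n\to\mathrm{GL}_n(\mathbb{C})$ for which there are matrices $S,X_0,\dots,X_{k-1}\in\mathrm{GL}_2(\mathbb{C})$ with $\beta(\sigma_i)=E_i(S)$ and $\beta(\rho_i^\alpha)=E_i(X_\alpha)$ for all $1\le i\le n-1$ and $0\le\alpha\le k-1$. Two representations are equivalent if they are conjugate by a fixed invertible matrix. *)

(* Defs.v *)
From HB Require Import structures.
From mathcomp Require Import all_boot all_order all_algebra.
From mathcomp Require Import boolp reals complex.

Set Implicit Arguments.
Unset Strict Implicit.
Unset Printing Implicit Defensive.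

Import GRing.Theory.

(* A letter (x, false) stands for the generator x, and (x, true) for its      *)
(* formal inverse. [rels u v] is the defining relation u = v.                 *)
Definition word (X : Type) := seq (X * bool).

Section Presentation.
Variables (X : choiceType) (rels : word X -> word X -> Prop).

Definition invw (u : word X) : word X := rev [seq (a.1, ~~ a.2) | a <- u].

Inductive pres_eq : word X -> word X -> Prop :=
  | pres_rel u v : rels u v -> pres_eq u v
  | pres_cancel x b : pres_eq [:: (x, b); (x, ~~ b)] [::]
  | pres_refl u : pres_eq u u
  | pres_sym u v : pres_eq u v -> pres_eq v u
  | pres_trans v u w : pres_eq u v -> pres_eq v w -> pres_eq u w
  | pres_cat u u' v v' :
      pres_eq u u' -> pres_eq v v' -> pres_eq (u ++ v) (u' ++ v').

Definition pres_eqb (u v : word X) : bool := `[< pres_eq u v >].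

Lemma pres_eqb_refl : reflexive pres_eqb.
Proof. by move=> u; apply/asboolP/pres_refl. Qed.

Lemma pres_eqb_sym : symmetric pres_eqb.
Proof. by move=> u v; apply/asboolP/asboolP => /pres_sym. Qed.

Lemma pres_eqb_trans : transitive pres_eqb.
Proof.
by move=> v u w /asboolP uv /asboolP vw; apply/asboolP/(pres_trans uv vw).
Qed.

Canonical pres_equiv :=
  EquivRel pres_eqb pres_eqb_refl pres_eqb_sym pres_eqb_trans.

Definition presented := {eq_quot pres_equiv}%qT.
HB.instance Definition _ := Choice.on presented.

Definition of_word (u : word X) : presented := \pi_presented%qT u.

Definition gen (x : X) : presented := of_word [:: (x, false)].

Lemma of_wordP u v : of_word u = of_word v <-> pres_eq u v.
Proof.
split=> [/eqmodP/asboolP //|uv].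
by apply/eqmodP/asboolP.
Qed.

Lemma of_word_repr (x : presented) : of_word (repr x) = x.
Proof. exact: reprK. Qed.

Lemma pres_eq_repr u : pres_eq (repr (of_word u)) u.
Proof. by apply/of_wordP; rewrite of_word_repr. Qed.

Lemma invwK : involutive invw.
Proof.
move=> u; rewrite /invw map_rev revK -map_comp -[RHS]map_id.
by apply: eq_map => -[x b] /=; rewrite negbK.
Qed.

Lemma invw_cat u v : invw (u ++ v) = invw v ++ invw u.
Proof. by rewrite /invw map_cat rev_cat. Qed.

Lemma pres_eq_catV u : pres_eq (u ++ invw u) [::].
Proof.
elim: u => [|[x b] u IHu]; first exact: pres_refl.
rewrite -[_ :: u]cat1s invw_cat -catA (catA u).
apply: (@pres_trans ([:: (x, b)] ++ [::] ++ invw [:: (x, b)])).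
  by apply: pres_cat; [exact: pres_refl | apply: pres_cat IHu (pres_refl _)].
exact: pres_cancel.
Qed.

Lemma pres_eq_inv u v : pres_eq u v -> pres_eq (invw u) (invw v).
Proof.
move=> uv; have Vu : pres_eq (invw u ++ u) [::].
  by rewrite -{2}(invwK u); exact: pres_eq_catV.
apply: (@pres_trans (invw u ++ (v ++ invw v))).
  rewrite -{1}(cats0 (invw u)).
  by apply: pres_cat (pres_refl _) (pres_sym (pres_eq_catV v)).
rewrite catA; apply: (@pres_trans ([::] ++ invw v)); last exact: pres_refl.
apply: pres_cat (pres_refl _); apply: pres_trans Vu.
exact: pres_cat (pres_refl _) (pres_sym uv).
Qed.

Definition pres_one : presented := of_word [::].
Definition pres_mul (x y : presented) := of_word (repr x ++ repr y).
Definition pres_inv (x : presented) := of_word (invw (repr x)).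

Lemma pres_mulE u v : pres_mul (of_word u) (of_word v) = of_word (u ++ v).
Proof. by apply/of_wordP/pres_cat; exact: pres_eq_repr. Qed.

Lemma pres_invE u : pres_inv (of_word u) = of_word (invw u).
Proof. by apply/of_wordP/pres_eq_inv; exact: pres_eq_repr. Qed.

Lemma pres_mulA : associative pres_mul.
Proof.
move=> x y z; rewrite -(of_word_repr x) -(of_word_repr y) -(of_word_repr z).
by rewrite !pres_mulE catA.
Qed.

Lemma pres_mul1 : left_id pres_one pres_mul.
Proof. by move=> x; rewrite -(of_word_repr x) pres_mulE. Qed.

Lemma pres_mulr1 : right_id pres_one pres_mul.
Proof. by move=> x; rewrite -(of_word_repr x) pres_mulE cats0. Qed.

Lemma pres_mulV : right_inverse pres_one pres_inv pres_mul.
Proof.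
move=> x; rewrite -(of_word_repr x) pres_invE pres_mulE.
exact/of_wordP/pres_eq_catV.
Qed.

Lemma pres_mulVl : left_inverse pres_one pres_inv pres_mul.
Proof.
move=> x; rewrite -(of_word_repr x) pres_invE pres_mulE -{2}(invwK (repr x)).
exact/of_wordP/pres_eq_catV.
Qed.

HB.instance Definition _ := hasMul.Build presented pres_mul.
HB.instance Definition _ := Magma_isSemigroup.Build presented pres_mulA.
HB.instance Definition _ :=
  Magma_isUMagma.Build presented pres_mul1 pres_mulr1.
HB.instance Definition _ := hasInv.Build presented pres_inv.
HB.instance Definition _ :=
  Monoid_isGroup.Build presented pres_mulVl pres_mulV.

Lemma of_word_cat u v : of_word (u ++ v) = (of_word u * of_word v)%g.
Proof. by rewrite -pres_mulE. Qed.

Lemma of_word_rel u v : rels u v -> of_word u = of_word v.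
Proof. by move=> uv; apply/of_wordP/pres_rel. Qed.

Section Lift.
Variables (G : groupType) (f : X -> G).

Definition eval_word (u : word X) : G :=
  (\prod_(a <- u) (if a.2 then (f a.1)^-1 else f a.1))%g.

Hypothesis f_rels : forall u v, rels u v -> eval_word u = eval_word v.

Lemma eval_pres_eq u v : pres_eq u v -> eval_word u = eval_word v.
Proof.
elim=> {u v} [u v /f_rels //|x b|//|u v _ -> //|v u w _ -> _ -> //|].
- by rewrite /eval_word !big_cons big_nil mulg1; case: b; rewrite /= gsimp.
- move=> u u' v v' _ IHu _ IHv.
  by move: IHu IHv; rewrite /eval_word !big_cat /= => -> ->.
Qed.

Lemma pres_lift :
  exists h : {multiplicative presented -> G}, forall x, h (gen x) = f x.
Proof.
pose h (x : presented) := eval_word (repr x).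
have hE u : h (of_word u) = eval_word u by apply/eval_pres_eq/pres_eq_repr.
have hM : {morph h : x y / (x * y)%g}.
  move=> x y; rewrite -(of_word_repr x) -(of_word_repr y) -of_word_cat !hE.
  by rewrite /eval_word big_cat.
pose hm := isMultiplicative.Build _ _ h hM.
pose hh : {multiplicative presented -> G} := HB.pack h hm.
by exists hh => x; rewrite /= hE /eval_word big_seq1.
Qed.

End Lift.
End Presentation.

(* Indices are 0-based: i : 'I_n.-1 stands for the 1-based i + 1, and         *)
(* [Rho a i] is rho_{i+1}^a, where a : 'I_k is the superscript.               *)
Inductive mkvb_gen (n k : nat) :=
  | Sigma of 'I_n.-1
  | Rho of 'I_k & 'I_n.-1.

Section MkvbGenChoice.
Variables n k : nat.

Definition mkvb_gen_code (x : mkvb_gen n k) : 'I_n.-1 + 'I_k * 'I_n.-1 :=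
  match x with Sigma i => inl i | Rho a i => inr (a, i) end.
Definition mkvb_gen_decode (x : 'I_n.-1 + 'I_k * 'I_n.-1) : mkvb_gen n k :=
  match x with inl i => Sigma k i | inr (a, i) => Rho a i end.

Lemma mkvb_gen_codeK : cancel mkvb_gen_code mkvb_gen_decode.
Proof. by case. Qed.

HB.instance Definition _ := Choice.copy (mkvb_gen n k) (can_type mkvb_gen_codeK).

End MkvbGenChoice.

Definition far (i j : nat) : bool := (i.+1 < j)%N || (j.+1 < i)%N.

Section MkvbRelations.
Variables n k : nat.
Local Notation s i := (Sigma k i, false).
Local Notation r a i := (@Rho n k a i, false).

Inductive mkvb_rels : word (mkvb_gen n k) -> word (mkvb_gen n k) -> Prop :=
  | sigma_braid (i j : 'I_n.-1) : j = i.+1 :> nat ->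
      mkvb_rels [:: s i; s j; s i] [:: s j; s i; s j]
  | sigma_comm (i j : 'I_n.-1) : far i j ->
      mkvb_rels [:: s i; s j] [:: s j; s i]
  | rho_square (a : 'I_k) (i : 'I_n.-1) :
      mkvb_rels [:: r a i; r a i] [::]
  | rho_comm (a : 'I_k) (i j : 'I_n.-1) : far i j ->
      mkvb_rels [:: r a i; r a j] [:: r a j; r a i]
  | rho_braid (a : 'I_k) (i j : 'I_n.-1) : j = i.+1 :> nat ->
      mkvb_rels [:: r a i; r a j; r a i] [:: r a j; r a i; r a j]
  | sigma_rho_comm (a : 'I_k) (i j : 'I_n.-1) : far i j ->
      mkvb_rels [:: s i; r a j] [:: r a j; s i]
  | rho_rho_comm (a b : 'I_k) (i j : 'I_n.-1) : far i j -> a != b ->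
      mkvb_rels [:: r a i; r b j] [:: r b j; r a i]
  | sigma_mixed (o : 'I_k) (i j : 'I_n.-1) : o = 0 :> nat -> j = i.+1 :> nat ->
      mkvb_rels [:: s i; r o j; r o i] [:: r o j; r o i; s j]
  | rho_mixed (o b : 'I_k) (i j : 'I_n.-1) :
      o = 0 :> nat -> (1 <= b)%N -> j = i.+1 :> nat ->
      mkvb_rels [:: r o i; r o j; r b i] [:: r b j; r o i; r o j].

End MkvbRelations.

Definition MkVB (n k : nat) : groupType := presented (@mkvb_rels n k).
Definition sigma (n k : nat) (i : 'I_n.-1) : MkVB n k :=
  gen (@mkvb_rels n k) (Sigma k i).
Definition rho (n k : nat) (a : 'I_k) (i : 'I_n.-1) : MkVB n k :=
  gen (@mkvb_rels n k) (Rho a i).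
Arguments sigma n k i : clear implicits.
Arguments rho n k a i : clear implicits.

(* MathComp's {'GL_n[F]} is restricted to finite rings. *)
Section GeneralLinearGroup.
Variables (F : fieldType) (n : nat).

Record GL := MkGL { GL_mx :> 'M[F]_n; GL_unit : GL_mx \in unitmx }.

HB.instance Definition _ := [isSub for GL_mx].
HB.instance Definition _ := [Choice of GL by <:].

Lemma GL_one_unit : (1%:M : 'M[F]_n)%R \in unitmx.
Proof. exact: unitmx1. Qed.
Lemma GL_mul_unit (A B : GL) : (A *m B)%R \in unitmx.
Proof. by rewrite unitmx_mul !GL_unit. Qed.
Lemma GL_inv_unit (A : GL) : invmx A \in unitmx.
Proof. by rewrite unitmx_inv GL_unit. Qed.

Definition GL_one := MkGL GL_one_unit.
Definition GL_mul (A B : GL) := MkGL (GL_mul_unit A B).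
Definition GL_inv (A : GL) := MkGL (GL_inv_unit A).

Lemma GL_mulA : associative GL_mul.
Proof. by move=> A B C; apply/val_inj/mulmxA. Qed.
Lemma GL_mul1 : left_id GL_one GL_mul.
Proof. by move=> A; apply/val_inj/mul1mx. Qed.
Lemma GL_mulr1 : right_id GL_one GL_mul.
Proof. by move=> A; apply/val_inj/mulmx1. Qed.
Lemma GL_mulV : left_inverse GL_one GL_inv GL_mul.
Proof. by move=> A; apply/val_inj/mulVmx/GL_unit. Qed.
Lemma GL_mulrV : right_inverse GL_one GL_inv GL_mul.
Proof. by move=> A; apply/val_inj/mulmxV/GL_unit. Qed.

HB.instance Definition _ := hasMul.Build GL GL_mul.
HB.instance Definition _ := Magma_isSemigroup.Build GL GL_mulA.
HB.instance Definition _ := Magma_isUMagma.Build GL GL_mul1 GL_mulr1.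
HB.instance Definition _ := hasInv.Build GL GL_inv.
HB.instance Definition _ := Monoid_isGroup.Build GL GL_mulV GL_mulrV.

End GeneralLinearGroup.

Local Open Scope ring_scope.

Section LocalMatrix.
Variables (F : fieldType) (n : nat).

Lemma local_dim (i : 'I_n.-1) : (i + (2 + (n - i - 2)) = n)%N.
Proof.
have := ltn_ord i; rewrite -subnDA addnA ltn_predRL => lti.
by rewrite subnKC // addn2.
Qed.

(* diag (I_i, M, I_(n-2-i)); with i 0-based, this is the 1-based E_(i+1).    *)
Definition E (i : 'I_n.-1) (M : 'M[F]_2) : 'M[F]_n :=
  castmx (local_dim i, local_dim i)
    (block_mx 1%:M 0 0 (block_mx M 0 0 1%:M)).

Lemma E_entry (i : 'I_n.-1) (M : 'M[F]_2) (p q : 'I_n) :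
  E i M p q =
    if [&& (i <= p)%N, (p < i.+2)%N, (i <= q)%N & (q < i.+2)%N]
    then M (inord (p - i)) (inord (q - i)) else (p == q)%:R.
Proof.
rewrite /E castmxE /= !mxE.
set e := esym (local_dim i).
have -> : (p == q) = (cast_ord e p == cast_ord e q) by [].
have -> : nat_of_ord p = cast_ord e p by [].
have -> : nat_of_ord q = cast_ord e q by [].
move: (cast_ord e p) (cast_ord e q) => p' q'.
case: splitP => [p1|p1] p1E; rewrite ?mxE; case: splitP => [q1|q1] q1E.
- by rewrite !mxE -!(inj_eq val_inj) /= p1E q1E leqNgt ltn_ord.
- rewrite !mxE -(inj_eq val_inj) /= p1E q1E leqNgt ltn_ord /=.
  by rewrite ltn_eqF // ltn_addr.
- rewrite !mxE -(inj_eq val_inj) /= p1E q1E (leqNgt i q1) ltn_ord /= !andbF.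
  by rewrite gtn_eqF // ltn_addr.
rewrite -(inj_eq val_inj) /= p1E q1E !leq_addr -(addn2 i) !ltn_add2l !addKn.
rewrite eqn_add2l /block_mx mxE.
case: splitP => [p2|p2] p2E; rewrite mxE; case: splitP => [q2|q2] q2E;
  rewrite ?mxE p2E q2E ?ltn_ord ?inord_val //=.
- by rewrite ltn_eqF // ltn_addr.
- by rewrite gtn_eqF // ltn_addr.
Qed.

End LocalMatrix.

Definition mx2 (F : fieldType) (a b c d : F) : 'M[F]_2 :=
  \matrix_(i < 2, j < 2) nth 0 (nth [::] [:: [:: a; b]; [:: c; d]] i) j.

Section Representations.
Variables (R : realType) (n k : nat).
Local Notation C := R[i].

Definition representation := {multiplicative MkVB n k -> GL C n}.

Definition homogeneous_2local (beta : representation) : Prop :=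
  exists (S : GL C 2) (X : 'I_k -> GL C 2),
    (forall i, beta (sigma n k i) = E i S :> 'M_n) /\
    (forall a i, beta (rho n k a i) = E i (X a) :> 'M_n).

Definition equivalent (beta beta' : representation) : Prop :=
  exists P : GL C n, forall g, beta g = (beta' g ^ P)%g.

End Representations.

(* S_left and S_right allow a nonzero upper-left, resp. lower-right, entry.   *)
Inductive S_form := S_id | S_left | S_anti | S_right.

Definition S_form_code (s : S_form) : bool * bool :=
  match s with
  | S_id => (false, false) | S_left => (false, true)
  | S_anti => (true, false) | S_right => (true, true)
  end.
Definition S_form_decode (b : bool * bool) : S_form :=
  match b with
  | (false, false) => S_id | (false, true) => S_left
  | (true, false) => S_anti | (true, true) => S_right
  end.
Lemma S_form_codeK : cancel S_form_code S_form_decode.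
Proof. by case. Qed.
HB.instance Definition _ := Finite.copy S_form (can_type S_form_codeK).

Definition has_S_form (F : fieldType) (s : S_form) (S : 'M[F]_2) : Prop :=
  match s with
  | S_id => S = mx2 1 0 0 1
  | S_left => exists b c : F, b * c != 0 /\ S = mx2 (1 - b * c) b c 0
  | S_anti => exists b c : F, b * c != 0 /\ S = mx2 0 b c 0
  | S_right => exists c d : F,
      [/\ c != 0, d != 1 & S = mx2 0 (- ((d - 1) / c)) c d]
  end.

Definition has_swap_form (F : fieldType) (X : 'M[F]_2) : Prop :=
  exists x : F, x != 0 /\ X = mx2 0 x (1 / x) 0.

(* [e a = true] selects the antidiagonal form of X_a, and [e a = false] the   *)
(* identity, for 1 <= a <= k - 1.                                             *)
Definition X_forms (k : nat) := {ffun {a : 'I_k | (0 < a)%N} -> bool}.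

Definition has_X_forms (F : fieldType) (k : nat) (e : X_forms k)
    (X : 'I_k -> 'M[F]_2) : Prop :=
  (forall o : 'I_k, o = 0 :> nat -> has_swap_form (X o)) /\
  (forall a : {a : 'I_k | (0 < a)%N},
     if e a then has_swap_form (X (val a)) else X (val a) = mx2 1 0 0 1).

(* [None] is the trivial type. *)
Definition rep_type (k : nat) := option (S_form * X_forms k).

Section RepresentationTypes.
Variables (R : realType) (n k : nat).
Local Notation C := R[i].

Definition is_of_form (beta : representation R n k)
    (S : 'M[C]_2) (X : 'I_k -> 'M[C]_2) : Prop :=
  (forall i, beta (sigma n k i) = E i S :> 'M_n) /\
  (forall a i, beta (rho n k a i) = E i (X a) :> 'M_n).

Definition of_type (t : rep_type k) (beta : representation R n k) : Prop :=
  match t with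
  | None =>
      (forall i, beta (sigma n k i) = 1%g) /\
      (forall a i, beta (rho n k a i) = 1%g)
  | Some (s, e) => exists (S : 'M[C]_2) (X : 'I_k -> 'M[C]_2),
      [/\ has_S_form s S, has_X_forms e X & is_of_form beta S X]
  end.

Definition of_type_up_to_equiv (t : rep_type k) (beta : representation R n k) :=
  exists beta' : representation R n k, equivalent beta beta' /\ of_type t beta'.

End RepresentationTypes.

(* Main.v *)
Require Import Defs.
From HB Require Import structures.
From mathcomp Require Import all_boot all_order all_algebra.
From mathcomp Require Import boolp reals complex.
From mathcomp Require Import ring zify.

Set Implicit Arguments.
Unset Strict Implicit.
Unset Printing Implicit Defensive.

Import GRing.Theory Num.Theory.
Local Open Scope ring_scope.

(** Every defining relation involves at most three consecutive coordinates, so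
    everything comes down to 3 x 3 matrices. For a matrix [W] with orthonormal
    rows, [embed W A = 1 + W^T (A - 1) W] lets [A] act on the row space of [W]
    and the identity act on its orthogonal complement. It is an injective
    multiplicative map, it is functorial in [W], and two such matrices commute
    when their row spaces are orthogonal. Since [E i M] is an [embed] along the
    coordinates [i, i+1], the far commutation relations hold automatically,
    and a relation between the positions [i] and [i+1] holds if and only if it
    holds between [E3l = diag (M, 1)] and [E3r = diag (1, M)]
    ([E_consecutive_eq]).

    The 3 x 3 braid relation for [S = (a b; c d)] amounts to
    [abd = acd = 0], [a (a + bc - 1) = 0] and [d (d + bc - 1) = 0], whose
    invertible solutions are the four forms of [S] ([braid3_forms]). An
    involution that satisfies it is the identity or antidiagonal with
    [bc = 1]. If [X_0] is such a swap, then [E3l X_0 *m E3r X_0] is a weighted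
    3-cycle that conjugates [E3l M] into [E3r M] for every [M], so that the
    mixed relations constrain nothing more; if [X_0] is the identity, they say
    that [E3l M = E3r M], which forces [M] to be the identity. This gives the
    classification, with no change of basis, and the existence of all the
    representations.

    To separate the types, let [X_0] be a swap. Then the traces of
    [sigma_1] and of [sigma_1 rho_1 rho_2 rho_1] (all the rho's with
    superscript 0) determine the diagonal of [S]: the word
    [rho_1 rho_2 rho_1] exchanges the coordinates 1 and 3 up to weights, hence
    multiplying by it moves every diagonal entry of the 3 x 3 block of
    [sigma_1] off the diagonal except the one in the middle, the lower right
    entry of [S]. So the diagonal of [S], and the set of the [a] for which
    [X_a] is the identity, are invariant under equivalence. The diagonals
    allowed by the four forms are [(1, 1)], [(1 - bc, 0)], [(0, 0)] and
    [(0, d)]; each form except the antidiagonal one has a diagonal that no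
    other form has, which is enough to make the types pairwise distinct. *)

(** * Matrices acting on a few coordinates *)

Section Embedding.
Variable F : fieldType.

Definition embed m n (W : 'M[F]_(m, n)) (A : 'M[F]_m) : 'M[F]_n :=
  1%:M + W^T *m (A - 1%:M) *m W.

Lemma embed1 m n (W : 'M[F]_(m, n)) : embed W 1%:M = 1%:M.
Proof. by rewrite /embed subrr mulmx0 mul0mx addr0. Qed.

(** The case [l < m < n] is how a 2 x 2 block is seen inside a 3 x 3 one. *)
Lemma embed_comp l m n (V : 'M[F]_(l, m)) (W : 'M[F]_(m, n)) A :
  embed W (embed V A) = embed (V *m W) A.
Proof. by rewrite /embed addrAC subrr add0r trmx_mul !mulmxA. Qed.

Section Isometry.
Variables (m n : nat) (W : 'M[F]_(m, n)).
Hypothesis WW : W *m W^T = 1%:M.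

Lemma embedM A B : embed W (A *m B) = embed W A *m embed W B.
Proof.
rewrite /embed mulmxDl mulmxDr mulmx1 mul1mx mulmxDr mulmx1 -!addrA.
have -> : W^T *m (A - 1%:M) *m W *m (W^T *m (B - 1%:M) *m W)
        = W^T *m ((A - 1%:M) *m (B - 1%:M)) *m W.
  by rewrite -!mulmxA (mulmxA W W^T) WW mul1mx.
rewrite -!mulmxDl -!mulmxDr; congr (_ + _ *m _ *m _).
rewrite mulmxBl mulmxBr mul1mx mulmx1 addrCA [X in _ = _ + X]addrC subrK.
by rewrite [RHS]addrC addrA subrK.
Qed.

Lemma mul_embed A : W *m embed W A = A *m W.
Proof.
by rewrite mulmxDr mulmx1 !mulmxA WW mul1mx mulmxBl mul1mx addrC subrK.
Qed.

Lemma embed_inj : injective (embed W).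
Proof.
move=> A B /(congr1 (fun Z => W *m Z *m W^T)).
by rewrite !mul_embed -!mulmxA WW !mulmx1.
Qed.

Lemma embed_unit A : A \in unitmx -> embed W A \in unitmx.
Proof.
move=> uA; suff /mulmx1_unit[] : embed W A *m embed W (invmx A) = 1%:M by [].
by rewrite -embedM mulmxV // embed1.
Qed.

Lemma mxtrace_embed A : \tr (embed W A) = n%:R - m%:R + \tr A.
Proof.
rewrite mxtraceD mxtrace1 -mulmxA mxtrace_mulC -mulmxA WW mulmx1.
by rewrite raddfB /= mxtrace1 addrA addrAC.
Qed.

End Isometry.

Lemma embed_comm l m n (V : 'M[F]_(l, n)) (W : 'M[F]_(m, n)) A B :
  V *m W^T = 0 -> embed V A *m embed W B = embed W B *m embed V A.
Proof.
move=> VW; have WV : W *m V^T = 0 by rewrite -[W]trmxK -trmx_mul VW trmx0.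
rewrite /embed !(mulmxDl 1%:M) !(mulmxDr _ 1%:M) !mulmx1 !mul1mx -!mulmxA.
rewrite (mulmxA V) VW (mulmxA W) WV !mul0mx !mulmx0 !addr0.
by rewrite -!addrA; congr (_ + _); rewrite addrC.
Qed.

(** The coordinate rows [i, ..., i + m - 1] of the identity of size [n]. *)
Definition window m n (i : nat) : 'M[F]_(m, n) :=
  \matrix_(p, q) (q == i + p :> nat)%N%:R.

Lemma window_isometry m n i :
  (i + m <= n)%N -> window m n i *m (window m n i)^T = 1%:M.
Proof.
move=> le_n; apply/matrixP=> p q; rewrite !mxE.
have lt_p : (i + p < n)%N by have := ltn_ord p; lia.
rewrite (bigD1 (Ordinal lt_p)) //= !mxE eqxx mul1r eqn_add2l big1 ?addr0 //.
by move=> r; rewrite !mxE -(inj_eq val_inj) /= => /negPf ->; rewrite mul0r.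
Qed.

Lemma window_comp l m n i j :
  (j + l <= m)%N -> window l m j *m window m n i = window l n (i + j).
Proof.
move=> le_m; apply/matrixP=> p q; rewrite !mxE.
have lt_p : (j + p < m)%N by have := ltn_ord p; lia.
rewrite (bigD1 (Ordinal lt_p)) //= !mxE eqxx mul1r addnA big1 ?addr0 //.
by move=> r; rewrite !mxE -(inj_eq val_inj) /= => /negPf ->; rewrite mul0r.
Qed.

Lemma window_disjoint l m n i j :
  (i + l <= j)%N -> window l n i *m (window m n j)^T = 0.
Proof.
move=> le_j; apply/matrixP=> p q; rewrite !mxE big1 // => r _; rewrite !mxE.
rewrite -natrM mulnb; case: eqP => //= ->.
by rewrite (_ : (_ == _) = false) //; have := ltn_ord p; lia.
Qed.

(** * Two by two and three by three blocks *)

Lemma mx2_eta (M : 'M[F]_2) : M = mx2 (M 0 0) (M 0 1) (M 1 0) (M 1 1).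
Proof.
by apply/matrixP=> p q; rewrite mxE; case: p q => [[|[]]] // ? [[|[]]] // ? /=;
   congr (M _ _); apply: val_inj.
Qed.

Lemma mx2_inj (a b c d a' b' c' d' : F) :
  mx2 a b c d = mx2 a' b' c' d' -> [/\ a = a', b = b', c = c' & d = d'].
Proof.
by move/matrixP=> e; move: (e 0 0) (e 0 1) (e 1 0) (e 1 1); rewrite !mxE.
Qed.

Lemma mx2_1 : mx2 1 0 0 1 = 1%:M :> 'M[F]_2.
Proof. by rewrite [RHS]mx2_eta !mxE. Qed.

Lemma mulmx2 (a b c d a' b' c' d' : F) :
  mx2 a b c d *m mx2 a' b' c' d' =
  mx2 (a * a' + b * c') (a * b' + b * d') (c * a' + d * c') (c * b' + d * d').
Proof.
by rewrite [LHS]mx2_eta !mxE !big_ord_recl !big_ord0 !mxE /= !addr0.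
Qed.

Lemma unit_mx2 (a b c d : F) : mx2 a b c d \in unitmx = (a * d - b * c != 0).
Proof.
rewrite unitmxE unitfE (expand_det_row _ 0) !big_ord_recl big_ord0 addr0.
by rewrite /cofactor !det_mx11 !mxE /= expr0 mul1r expr1 mulN1r mulrN.
Qed.

Lemma sum_window n (i : nat) (f : 'I_2 -> F) (q : 'I_n) :
  \sum_s f s * window 2 n i s q =
    if (i <= q < i.+2)%N then f (inord (q - i)) else 0.
Proof.
case: ifP => [/andP[le_iq lt_qi]|out].
  have qE : (q = i + (inord (q - i) : 'I_2) :> nat)%N by rewrite inordK; lia.
  rewrite (bigD1 (inord (q - i))) //= mxE -qE eqxx mulr1 big1 ?addr0 // => s.
  move=> s_neq; rewrite mxE (_ : (_ == _) = false) ?mulr0 //.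
  apply: contraNF s_neq => /eqP q_s; apply/eqP/val_inj/eqP.
  by rewrite -(eqn_add2l i) -q_s -qE.
rewrite big1 // => s _; rewrite mxE (_ : (_ == _) = false) ?mulr0 //.
by have := ltn_ord s; lia.
Qed.

Lemma E_embed n (i : 'I_n.-1) (M : 'M[F]_2) : E i M = embed (window 2 n i) M.
Proof.
apply/matrixP=> p q; rewrite E_entry !mxE sum_window.
rewrite andbA; case: (boolP (i <= q < i.+2)%N) => [in_q|_]; last first.
  by rewrite andbF addr0.
rewrite andbT mxE; under eq_bigr => s _ do rewrite mxE mulrC.
rewrite sum_window; case: ifP => [in_p|]; rewrite ?addr0 //.
have -> : (p == q) = (inord (p - i) == inord (q - i) :> 'I_2).
  by rewrite -!(inj_eq val_inj) /= !inordK; lia.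
by rewrite !mxE addrC subrK.
Qed.

Definition mx3 (a b c d e f g h l : F) : 'M[F]_3 :=
  \matrix_(i < 3, j < 3)
    nth 0 (nth [::] [:: [:: a; b; c]; [:: d; e; f]; [:: g; h; l]] i) j.

Lemma mulmx3 (a b c d e f g h l a' b' c' d' e' f' g' h' l' : F) :
  mx3 a b c d e f g h l *m mx3 a' b' c' d' e' f' g' h' l' =
  mx3 (a * a' + b * d' + c * g') (a * b' + b * e' + c * h')
      (a * c' + b * f' + c * l')
      (d * a' + e * d' + f * g') (d * b' + e * e' + f * h')
      (d * c' + e * f' + f * l')
      (g * a' + h * d' + l * g') (g * b' + h * e' + l * h')
      (g * c' + h * f' + l * l').
Proof.
by apply/matrixP=> -[[|[|[]]]] // ? [[|[|[]]]] // ?;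
  rewrite !mxE !big_ord_recl big_ord0 !mxE /= addr0 addrA.
Qed.

Lemma mx3_inj (a b c d e f g h l a' b' c' d' e' f' g' h' l' : F) :
  mx3 a b c d e f g h l = mx3 a' b' c' d' e' f' g' h' l' ->
  [/\ [/\ a = a', b = b' & c = c'], [/\ d = d', e = e' & f = f']
    & [/\ g = g', h = h' & l = l']].
Proof.
move/matrixP=> eqM; have eqM' i j := eqM (inord i) (inord j).
move: (eqM' 0 0) (eqM' 0 1) (eqM' 0 2) (eqM' 1 0) (eqM' 1 1) (eqM' 1 2)
  (eqM' 2 0) (eqM' 2 1) (eqM' 2 2); by rewrite !mxE !inordK.
Qed.

Definition E3l (M : 'M[F]_2) := embed (window 2 3 0) M.
Definition E3r (M : 'M[F]_2) := embed (window 2 3 1) M.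

Lemma E3lE (a b c d : F) : E3l (mx2 a b c d) = mx3 a b 0 c d 0 0 0 1.
Proof.
rewrite /E3l -(@E_embed 3 (Ordinal (isT : 0 < 2)%N)).
by apply/matrixP=> -[[|[|[]]]] // ? [[|[|[]]]] // ?;
  rewrite E_entry !mxE /= ?inordK.
Qed.

Lemma E3rE (a b c d : F) : E3r (mx2 a b c d) = mx3 1 0 0 0 a b 0 c d.
Proof.
rewrite /E3r -(@E_embed 3 (Ordinal (isT : 1 < 2)%N)).
by apply/matrixP=> -[[|[|[]]]] // ? [[|[|[]]]] // ?;
  rewrite E_entry !mxE /= ?inordK.
Qed.

Lemma E_E3l n (i : 'I_n.-1) M : E i M = embed (window 3 n i) (E3l M).
Proof. by rewrite E_embed embed_comp window_comp // addn0. Qed.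

Lemma E_E3r n (i j : 'I_n.-1) M :
  j = i.+1 :> nat -> E j M = embed (window 3 n i) (E3r M).
Proof. by move=> ji; rewrite E_embed embed_comp window_comp // addn1 ji. Qed.

(** * Solutions of the braid relation *)

Definition braid3 (S : 'M[F]_2) :=
  E3l S *m E3r S *m E3l S = E3r S *m E3l S *m E3r S.

(** Turns an equation into an equivalent one that differs from it by a ring
    identity. *)
Lemma eq_of_subr (x y u v : F) : x = y -> u - v = x - y -> u = v.
Proof. by move=> ->; rewrite subrr => /eqP; rewrite subr_eq0 => /eqP. Qed.

(** Among the nine entries of the relation, four suffice. If [bc = 0], then
    [ad] is nonzero, so that [b = c = 0], and the two quadratic equations give
    [a = d = 1]; otherwise [ad = 0], and which of [a], [d] vanishes tells the
    form. *)
Lemma braid3_forms (S : 'M[F]_2) :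
  S \in unitmx -> braid3 S -> exists s, has_S_form s S.
Proof.
rewrite (mx2_eta S); move: (S 0 0) (S 0 1) (S 1 0) (S 1 1) => a b c d {S}.
rewrite unit_mx2 /braid3 !E3lE !E3rE !mulmx3 => uS.
move=> /mx3_inj[[e00 e01 _] [e10 _ _] [_ _ e22]].
have {e00} a_eq : a * (a + b * c - 1) = 0 by apply: (eq_of_subr e00); ring.
have {e01} bad : b * (a * d) = 0 by apply: (eq_of_subr e01); ring.
have {e10} cad : c * (a * d) = 0 by apply: (eq_of_subr e10); ring.
have {e22} d_eq : d * (d + b * c - 1) = 0.
  by apply: (eq_of_subr (esym e22)); ring.
have id_case : b * c = 0 -> exists s, has_S_form s (mx2 a b c d).
  move=> bc0; move: uS; rewrite bc0 subr0 => ad0; exists S_id.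
  move/eqP: bad; rewrite mulf_eq0 (negPf ad0) orbF => /eqP b0.
  move/eqP: cad; rewrite mulf_eq0 (negPf ad0) orbF => /eqP c0.
  move: ad0 a_eq d_eq; rewrite mulf_eq0 negb_or => /andP[a0 d0] /eqP + /eqP.
  rewrite b0 c0 mul0r !addr0 !mulf_eq0 (negPf a0) (negPf d0) !subr_eq0 /=.
  by move=> /eqP-> /eqP->.
have [/eqP|bc0] := eqVneq (b * c) 0; first by move/eqP.
have /andP[b0 c0] : (b != 0) && (c != 0) by rewrite -negb_or -mulf_eq0.
move/eqP: bad; rewrite !mulf_eq0 (negPf b0) /= => /orP[] /eqP z; subst.
  have [->|d0] := eqVneq d 0; first by exists S_anti, b, c.
  move/eqP: d_eq; rewrite mulf_eq0 (negPf d0) /= => /eqP d_eq.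
  have dE : d = 1 - b * c by apply: (eq_of_subr d_eq); ring.
  exists S_right, c, d; split=> //.
    by rewrite dE -subr_eq0 addrAC subrr add0r oppr_eq0.
  by congr mx2; rewrite dE; field.
have [->|a0] := eqVneq a 0; first by exists S_anti, b, c.
move/eqP: a_eq; rewrite mulf_eq0 (negPf a0) /= => /eqP a_eq.
exists S_left, b, c; split=> //; congr mx2; apply: (eq_of_subr a_eq); ring.
Qed.

Lemma braid3_of_form s (S : 'M[F]_2) : has_S_form s S -> braid3 S.
Proof.
rewrite /braid3; case: s => /=.
- by move=> ->; rewrite !E3lE !E3rE !mulmx3; congr mx3; ring.
- by case=> b [c [_ ->]]; rewrite !E3lE !E3rE !mulmx3; congr mx3; ring.
- by case=> b [c [_ ->]]; rewrite !E3lE !E3rE !mulmx3; congr mx3; ring.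
- by case=> c [d [c0 _ ->]]; rewrite !E3lE !E3rE !mulmx3; congr mx3; field.
Qed.

Lemma S_form_unit s (S : 'M[F]_2) : has_S_form s S -> S \in unitmx.
Proof.
case: s => /=.
- by move=> ->; rewrite mx2_1 unitmx1.
- by case=> b [c [bc0 ->]]; rewrite unit_mx2 mulr0 sub0r oppr_eq0.
- by case=> b [c [bc0 ->]]; rewrite unit_mx2 mulr0 sub0r oppr_eq0.
- case=> c [d [c0 d1 ->]]; rewrite unit_mx2 mul0r sub0r mulNr divfK // opprK.
  by rewrite subr_eq0.
Qed.

Lemma swap_S_form (X : 'M[F]_2) : has_swap_form X -> has_S_form S_anti X.
Proof.
case=> x [x0 ->]; exists x, (1 / x); split=> //.
by rewrite div1r divff // oner_neq0.
Qed.

Lemma swap_neq1 (X : 'M[F]_2) : has_swap_form X -> X != 1%:M.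
Proof.
case=> x [_ ->]; rewrite -mx2_1; apply/eqP=> /mx2_inj[/esym/eqP].
by rewrite oner_eq0.
Qed.

Lemma swap_square (X : 'M[F]_2) : has_swap_form X -> X *m X = 1%:M.
Proof. by case=> x [x0 ->]; rewrite mulmx2 -mx2_1; congr mx2; field. Qed.

(** In each of the last three forms, a diagonal entry of [X *m X] is [bc], so
    that [bc = 1]; this kills the remaining diagonal entry of [X]. *)
Lemma involutive_braid3 (X : 'M[F]_2) :
  X \in unitmx -> braid3 X -> X *m X = 1%:M -> X != 1%:M -> has_swap_form X.
Proof.
move=> uX /(braid3_forms uX)[s]; case: s => /=.
- by move=> ->; rewrite mx2_1 eqxx.
- case=> b [c [bc0 ->]]; rewrite mulmx2 -mx2_1 => /mx2_inj[_ _ _ bc1] _.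
  have {}bc1 : c * b = 1 by apply: (eq_of_subr bc1); ring.
  have b0 : b != 0 by apply: contraNneq bc0 => ->; rewrite mul0r.
  exists b; split=> //; congr mx2; first by rewrite mulrC bc1 subrr.
  by rewrite -bc1 mulfK.
- case=> b [c [bc0 ->]]; rewrite mulmx2 -mx2_1 => /mx2_inj[_ _ _ bc1] _.
  have {}bc1 : c * b = 1 by apply: (eq_of_subr bc1); ring.
  have b0 : b != 0 by apply: contraNneq bc0 => ->; rewrite mul0r.
  by exists b; split=> //; congr mx2; rewrite -bc1 mulfK.
- case=> c [d [c0 d1 ->]]; rewrite mulmx2 -mx2_1 => /mx2_inj[bc1 _ _ _] _.
  have {}bc1 : 1 - d = 1.
    by rewrite -[RHS]bc1; field.
  have d0 : d = 0 by apply: (eq_of_subr (esym bc1)); ring.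
  exists (1 / c); split; first by rewrite div1r invr_eq0.
  by congr mx2; rewrite ?d0 //; field; rewrite ?c0 ?oner_neq0.
Qed.

(** [E3l X *m E3r X] is the cyclic shift of the three coordinates, with weights,
    when [X] is a swap: it carries the block on the first two coordinates to
    the block on the last two, whatever this block is. *)
Lemma swap_conj (X M : 'M[F]_2) : has_swap_form X ->
  E3l X *m E3r X *m E3l M = E3r M *m E3l X *m E3r X.
Proof.
case=> x [x0 ->]; rewrite (mx2_eta M) !E3lE !E3rE !mulmx3.
by congr mx3; field.
Qed.

(** The inverse shift [E3r X *m E3l X] gives the relation in the reverse
    order. *)
Lemma swap_conjV (X M : 'M[F]_2) : has_swap_form X ->
  E3l M *m E3r X *m E3l X = E3r X *m E3l X *m E3r M.
Proof.
case=> x [x0 ->]; rewrite (mx2_eta M) !E3lE !E3rE !mulmx3.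
by congr mx3; field.
Qed.

(** The last three factors multiply to a weighted transposition of the
    coordinates 1 and 3, whose weight on the fixed coordinate 2 is
    [x * (1 / x) = 1]. *)
Lemma mxtrace_swap13 (X M : 'M[F]_2) : has_swap_form X ->
  \tr (E3l M *m E3l X *m E3r X *m E3l X) = M 1 1.
Proof.
case=> x [x0 ->]; rewrite (mx2_eta M) !E3lE !E3rE !mulmx3.
by rewrite /mxtrace !big_ord_recl big_ord0 !mxE /=; field.
Qed.

Lemma E3l_eq_E3r (M : 'M[F]_2) : E3l M = E3r M -> M = 1%:M.
Proof.
rewrite (mx2_eta M) E3lE E3rE => /mx3_inj[[-> -> _] [-> _ _] [_ _ <-]].
by rewrite mx2_1.
Qed.

(** * Relations between the local matrices *)

Section LocalRelations.
Variable n : nat.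
Implicit Types (i j : 'I_n.-1) (M N : 'M[F]_2).

Lemma window2_isometry i : window 2 n i *m (window 2 n i)^T = 1%:M.
Proof. by apply: window_isometry; have := ltn_ord i; lia. Qed.

Lemma window3_isometry i j :
  j = i.+1 :> nat -> window 3 n i *m (window 3 n i)^T = 1%:M.
Proof. by move=> ji; apply: window_isometry; have := ltn_ord j; lia. Qed.

Lemma E_unit i M : M \in unitmx -> E i M \in unitmx.
Proof. by rewrite E_embed; apply/embed_unit/window2_isometry. Qed.

Lemma EM i M N : E i M *m E i N = E i (M *m N).
Proof. by rewrite !E_embed embedM ?window2_isometry. Qed.

Lemma E1 i : E i 1%:M = 1%:M :> 'M[F]_n.
Proof. by rewrite E_embed embed1. Qed.

Lemma E_inj i : injective (E (F := F) i).
Proof.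
by move=> M N; rewrite !E_embed => /embed_inj; apply; exact: window2_isometry.
Qed.

Lemma mxtrace_E i M : \tr (E i M) = n%:R - 2 + \tr M.
Proof. by rewrite E_embed mxtrace_embed ?window2_isometry. Qed.

Lemma E_comm i j M N : far i j -> E i M *m E j N = E j N *m E i M.
Proof.
rewrite !E_embed => /orP[] far_ij; last apply: esym.
all: by apply/embed_comm/window_disjoint; rewrite addn2.
Qed.

(** All the relations between neighbouring generators have this shape; [->]
    extracts the constraints on the blocks from a representation, [<-] builds
    the representation. *)
Lemma E_consecutive_eq i j M1 M2 M3 N1 N2 N3 : j = i.+1 :> nat ->
  (E i M1 *m E j M2 *m E i M3 = E j N1 *m E i N2 *m E j N3) <->
  (E3l M1 *m E3r M2 *m E3l M3 = E3r N1 *m E3l N2 *m E3r N3).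
Proof.
move=> ji; have WW := window3_isometry ji.
rewrite !(E_E3r _ ji) !E_E3l -!embedM //.
by split=> [/(embed_inj WW)|->].
Qed.

End LocalRelations.
End Embedding.

(** * Homomorphisms out of a presented group *)

Section Homomorphisms.
Variables (X : choiceType) (rels : word X -> word X -> Prop) (G : groupType).
Variable h : {multiplicative presented rels -> G}.

Lemma hom_of_word u :
  h (of_word rels u) = eval_word (fun x => h (gen rels x)) u.
Proof.
have h1 : h 1%g = 1%g by apply: (mulgI (h 1%g)); rewrite -gmulfM !mulg1.
have hV x : h x^-1%g = (h x)^-1%g.
  by apply: (mulgI (h x)); rewrite -gmulfM !mulgV.
elim: u => [|[x b] u IHu]; first by rewrite /eval_word big_nil -[RHS]h1.
rewrite -cat1s of_word_cat gmulfM IHu /eval_word big_cons; congr (_ * _)%g.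
by case: b => //=; rewrite -hV; congr (h _);
  exact: esym (pres_invE _ [:: (x, false)]).
Qed.

(** The converse of [pres_lift]: images of the generators satisfy the
    relations. *)
Lemma hom_rel u v : rels u v ->
  eval_word (fun x => h (gen rels x)) u = eval_word (fun x => h (gen rels x)) v.
Proof. by move=> /of_word_rel uv; rewrite -!hom_of_word uv. Qed.

End Homomorphisms.

(** * Representations with given blocks *)

Section LocalRepresentations.
Variables (R : realType) (n k : nat).
Local Notation C := R[i].
Local Notation rep := (representation R n k).

Lemma local_rep (S : 'M[C]_2) (X : 'I_k -> 'M[C]_2) :
    S \in unitmx -> braid3 S ->
    (forall a, braid3 (X a)) -> (forall a, X a *m X a = 1%:M) ->
    (forall o : 'I_k, o = 0%N :> nat -> has_swap_form (X o)) ->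
  exists beta : rep, is_of_form beta S X.
Proof.
move=> uS brS brX XX swap0.
have uX a : X a \in unitmx by have [] := mulmx1_unit (XX a).
pose f x : GL C n := match x with
  | Sigma i => MkGL (E_unit i uS) | Rho a i => MkGL (E_unit i (uX a)) end.
have [|beta betaE] := @pres_lift _ (@mkvb_rels n k) _ f; last first.
  by exists beta; split=> [i|a i];
    rewrite ?/(sigma _ _ _) ?/(rho _ _ _ _) betaE.
move=> u v uv; apply: val_inj.
case: uv => [i j ij|i j ij|a i|a i j ij|a i j ij|a i j ij|a b i j ij _
            |o i j o0 ij|o b i j o0 b1 ij];
  rewrite /eval_word !big_cons !big_nil /= ?mulmx1 ?mulmxA.
- exact/(E_consecutive_eq _ _ _ _ _ _ ij).
- exact: E_comm.
- by rewrite EM XX E1.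
- exact: E_comm.
- exact/(E_consecutive_eq _ _ _ _ _ _ ij)/brX.
- exact: E_comm.
- exact: E_comm.
- exact/(E_consecutive_eq _ _ _ _ _ _ ij)/swap_conjV/swap0.
- exact/(E_consecutive_eq _ _ _ _ _ _ ij)/swap_conj/swap0.
Qed.

(** * Constraints on the blocks of a representation *)

Section Constraints.
Variables (beta : rep) (S : 'M[C]_2) (X : 'I_k -> 'M[C]_2).
Hypothesis betaSX : is_of_form beta S X.

Let f x : 'M[C]_n := match x with Sigma i => E i S | Rho a i => E i (X a) end.

Lemma is_of_form_gen x : beta (gen _ x) = f x :> 'M_n.
Proof. by case: x => [i|a i]; [apply: betaSX.1 | apply: betaSX.2]. Qed.

(** Both sides of a defining relation are positive words, so that the relation
    can be read as an equation between matrix products without inverses. *)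
Lemma is_of_form_rel u v : mkvb_rels u v -> all (fun a => ~~ a.2) (u ++ v) ->
  foldr (fun a => mulmx (f a.1)) 1%:M u = foldr (fun a => mulmx (f a.1)) 1%:M v.
Proof.
move=> uv; rewrite all_cat => /andP[pos_u pos_v].
have fE w : all (fun a => ~~ a.2) w -> foldr (fun a => mulmx (f a.1)) 1%:M w =
    eval_word (fun x => beta (gen _ x)) w :> 'M_n.
  elim: w => [|[x b] w IHw] /=; first by rewrite /eval_word big_nil.
  by case: b => //= /IHw ->; rewrite /eval_word big_cons /= -is_of_form_gen.
by rewrite !fE // (hom_rel beta uv).
Qed.

Variables i j : 'I_n.-1.
Hypothesis ij : j = i.+1 :> nat.

Lemma is_of_form_braidS : braid3 S.
Proof.
have := is_of_form_rel (sigma_braid k ij) isT.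
by rewrite /= !mulmx1 !mulmxA => /(E_consecutive_eq _ _ _ _ _ _ ij).
Qed.

Lemma is_of_form_braidX a : braid3 (X a).
Proof.
have := is_of_form_rel (rho_braid a ij) isT.
by rewrite /= !mulmx1 !mulmxA => /(E_consecutive_eq _ _ _ _ _ _ ij).
Qed.

Lemma is_of_form_square a : X a *m X a = 1%:M.
Proof.
have := is_of_form_rel (rho_square a i) isT.
by rewrite /= !mulmx1 EM -(E1 C i) => /E_inj.
Qed.

(** With [X_0] the identity, the mixed relations read [E i M = E j M] for [M]
    any other block. *)
Lemma is_of_form_rho0_trivial (o : 'I_k) : o = 0%N :> nat -> X o = 1%:M ->
  S = 1%:M /\ forall a, X a = 1%:M.
Proof.
move=> o0 Xo.
have E31 : (E3l 1%:M = 1%:M :> 'M[C]_3) * (E3r 1%:M = 1%:M :> 'M[C]_3).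
  by rewrite /E3l /E3r !embed1.
split=> [|a]; apply: E3l_eq_E3r.
  have := is_of_form_rel (sigma_mixed o0 ij) isT.
  rewrite /= !mulmx1 !mulmxA => /(E_consecutive_eq _ _ _ _ _ _ ij).
  by rewrite Xo !E31 !mulmx1 !mul1mx.
have [a0|a_gt0] := posnP a.
  by rewrite (_ : a = o) ?Xo ?E31 //; apply: val_inj; rewrite /= a0.
have := is_of_form_rel (rho_mixed o0 a_gt0 ij) isT.
rewrite /= !mulmx1 !mulmxA => /(E_consecutive_eq _ _ _ _ _ _ ij).
by rewrite Xo !E31 !mulmx1 !mul1mx.
Qed.

Lemma is_of_form_mxtrace13 (o : 'I_k) : has_swap_form (X o) ->
  \tr (beta (sigma n k i * rho n k o i * rho n k o j * rho n k o i)%g) =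
    n%:R - 3 + S 1 1.
Proof.
move=> swap_o; rewrite !gmulfM /= betaSX.1 !betaSX.2.
have WW := window3_isometry C ij.
rewrite (E_E3r _ ij) !E_E3l -!(embedM WW) (mxtrace_embed WW).
by rewrite mxtrace_swap13.
Qed.

Lemma rho_eq1 a : beta (rho n k a i) = 1%g <-> X a = 1%:M.
Proof.
split=> [e|Xa]; last by apply: val_inj; rewrite /= betaSX.2 Xa E1.
by apply: (@E_inj C n i); rewrite -betaSX.2 e E1.
Qed.

End Constraints.

(** * Invariants of equivalence *)

Lemma equivalent_mxtrace (beta beta' : rep) g :
  equivalent beta beta' -> \tr (beta g) = \tr (beta' g).
Proof.
case=> P ->; rewrite conjgE mulgA /= mxtrace_mulC mulmxA.
by rewrite mulmxV ?mul1mx // Defs.GL_unit.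
Qed.

Lemma equivalent_eq1 (beta beta' : rep) g :
  equivalent beta beta' -> beta g = 1%g <-> beta' g = 1%g.
Proof.
case=> P ->; split=> [e|->]; last by rewrite conj1g.
by rewrite -[beta' g](conjgK P) e conj1g.
Qed.

(** The word of [is_of_form_mxtrace13] gives the lower right entry of [S], and
    the trace of [sigma] gives the sum of the two diagonal entries. *)
Lemma equivalent_diag (i j : 'I_n.-1) (o : 'I_k) (beta beta' : rep) S S' X X' :
    j = i.+1 :> nat -> is_of_form beta S X -> is_of_form beta' S' X' ->
    has_swap_form (X o) -> has_swap_form (X' o) -> equivalent beta beta' ->
  S 0 0 = S' 0 0 /\ S 1 1 = S' 1 1.
Proof.
move=> ij bSX bSX' swap swap' eqv.
have := equivalent_mxtrace
  (sigma n k i * rho n k o i * rho n k o j * rho n k o i)%g eqv.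
rewrite (is_of_form_mxtrace13 bSX ij) // (is_of_form_mxtrace13 bSX' ij) //.
move=> /addrI e11; split=> //.
have := equivalent_mxtrace (sigma n k i) eqv.
rewrite bSX.1 bSX'.1 !mxtrace_E => /addrI.
rewrite /mxtrace !(big_ord_recl 1) !big_ord1.
rewrite (_ : lift ord0 ord0 = 1); last exact: val_inj.
by rewrite e11 => /addIr.
Qed.

(** * The types *)

Lemma X_forms_swap_or_1 (e : X_forms k) (X : 'I_k -> 'M[C]_2) a :
  has_X_forms e X -> has_swap_form (X a) \/ X a = 1%:M.
Proof.
case=> X0 Xe; have [a0|a_gt0] := posnP a; first by left; apply: X0.
by have := Xe (Sub a a_gt0); rewrite SubK mx2_1; case: ifP; [left|right].
Qed.

Lemma X_formsE (e : X_forms k) (X : 'I_k -> 'M[C]_2) a :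
  has_X_forms e X -> e a = (X (val a) != 1%:M).
Proof.
by case=> _ /(_ a); case: (e a) => [/swap_neq1->|->] //; rewrite mx2_1 eqxx.
Qed.

Lemma form_rep s (e : X_forms k) (S : 'M[C]_2) (X : 'I_k -> 'M[C]_2) :
  has_S_form s S -> has_X_forms e X -> exists beta : rep, is_of_form beta S X.
Proof.
move=> Ss Xe; apply: local_rep.
- exact: S_form_unit Ss.
- exact: braid3_of_form Ss.
- move=> a; have [/swap_S_form/braid3_of_form//|->] := X_forms_swap_or_1 a Xe.
  by apply: (@braid3_of_form _ S_id); rewrite /= mx2_1.
- move=> a; have [/swap_square//|->] := X_forms_swap_or_1 a Xe.
  by rewrite mulmx1.
- exact: Xe.1.
Qed.

(** Parameters chosen in general position: the diagonals are [(1, 1)],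
    [(-1, 0)], [(0, 0)] and [(0, 2)]. They are written out as the forms require
    them, with [b = 2, c = 1] for [S_left] and [c = 1, d = 2] for [S_right]. *)
Definition S_witness (s : S_form) : 'M[C]_2 :=
  match s with
  | S_id => mx2 1 0 0 1
  | S_left => mx2 (1 - 2 * 1) 2 1 0
  | S_anti => mx2 0 1 1 0
  | S_right => mx2 0 (- ((2 - 1) / 1)) 1 2
  end.

Definition X_witness (e : X_forms k) (a : 'I_k) : 'M[C]_2 :=
  if insub a is Some a' then (if e a' then mx2 0 1 1 0 else mx2 1 0 0 1)
  else mx2 0 1 1 0.

Lemma S_witness_form s : has_S_form s (S_witness s).
Proof.
have two0 : 2 != 0 :> C by rewrite pnatr_eq0.
case: s => //=.
- by exists 2, 1; rewrite mulr1.
- by exists 1, 1; rewrite mulr1 oner_eq0.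
- exists 1, 2; split; rewrite ?oner_eq0 // -subr_eq0.
  by rewrite (_ : 2 - 1 = 1) ?oner_eq0 //; ring.
Qed.

Lemma X_witness_forms e : has_X_forms e (X_witness e).
Proof.
have swap1 : has_swap_form (mx2 0 1 1 0 : 'M[C]_2).
  by exists 1; rewrite oner_eq0 divr1.
split=> [o o0|a]; rewrite /X_witness; last by rewrite valK; case: (e a).
by case: insubP => [u|//]; rewrite o0.
Qed.

(** The exception is unavoidable: the diagonal [(0, 0)] of the antidiagonal
    form also occurs in [S_left] for [bc = 1] and in [S_right] for [d = 0]. *)
Lemma S_witness_diag s s' (S : 'M[C]_2) : has_S_form s' S ->
  S_witness s 0 0 = S 0 0 -> S_witness s 1 1 = S 1 1 -> s = s' \/ s = S_anti.
Proof.
have two0 : 2 != 0 :> C by rewrite pnatr_eq0.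
have one0 : 1 != 0 :> C by rewrite oner_eq0.
have E12 : 1 - 2 * 1 = - 1 :> C by ring.
case: s' => /= [->|[b [c [_ ->]]]|[b [c [_ ->]]]|[c [d [_ _ ->]]]];
  case: s => /=; rewrite !mxE /= ?E12 => /eqP e00 /eqP e11;
  try (by left); try (by right); move: e00 e11;
  by rewrite ?oppr_eq0 ?(eq_sym 0) ?(negPf one0) ?(negPf two0).
Qed.

Lemma witness_type s s' (e e' : X_forms k) (i j : 'I_n.-1) (o : 'I_k)
    (beta : rep) : j = i.+1 :> nat -> o = 0%N :> nat ->
    is_of_form beta (S_witness s) (X_witness e) ->
  of_type_up_to_equiv (Some (s', e')) beta -> e = e' /\ (s = s' \/ s = S_anti).
Proof.
move=> ij o0 bSX [beta' [eqv [S' [X' [Ss' Xe' bSX']]]]].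
have Xe := X_witness_forms e.
split.
  apply/ffunP=> a; rewrite (X_formsE a Xe) (X_formsE a Xe'); congr (~~ _).
  apply/eqP/eqP; rewrite -(rho_eq1 bSX i) -(rho_eq1 bSX' i);
    by move/(equivalent_eq1 _ eqv).
have [] := equivalent_diag ij bSX bSX' (Xe.1 o o0) (Xe'.1 o o0) eqv.
exact: S_witness_diag.
Qed.

Lemma trivial_rep : exists beta : rep, of_type None beta.
Proof.
pose h (_ : MkVB n k) : GL C n := 1%g.
have hM : {morph h : x y / (x * y)%g} by move=> x y; rewrite /h mulg1.
pose hm := isMultiplicative.Build _ _ h hM.
pose hh : {multiplicative MkVB n k -> GL C n} := HB.pack h hm.
by exists hh.
Qed.

Lemma of_type_equiv t (beta : rep) :
  of_type t beta -> of_type_up_to_equiv t beta.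
Proof. by exists beta; split=> //; exists 1%g => g; rewrite conjg1. Qed.

Lemma trivial_not_form s (e : X_forms k) (i : 'I_n.-1) (o : 'I_k) (beta : rep) :
  o = 0%N :> nat -> of_type None beta ->
  ~ of_type_up_to_equiv (Some (s, e)) beta.
Proof.
move=> o0 [_ b1] [beta' [eqv [S [X [_ Xe bSX]]]]].
have /(equivalent_eq1 _ eqv)/(rho_eq1 bSX) Xo := b1 o i.
by have := swap_neq1 (Xe.1 o o0); rewrite Xo eqxx.
Qed.

(** By [witness_type] in both directions, two types with the same
    representations share [e], and each of the two forms of [S] is equal to the
    other or antidiagonal. *)
Lemma types_distinct (i j : 'I_n.-1) (o : 'I_k) (t t' : rep_type k) :
    j = i.+1 :> nat -> o = 0%N :> nat ->
    (forall beta : rep,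
       of_type_up_to_equiv t beta <-> of_type_up_to_equiv t' beta) ->
  t = t'.
Proof.
move=> ij o0.
have std_rep s e := form_rep (S_witness_form s) (X_witness_forms e).
have std_type s e (beta : rep) : is_of_form beta (S_witness s) (X_witness e) ->
    of_type_up_to_equiv (Some (s, e)) beta.
  move=> bSX; apply: of_type_equiv; exists (S_witness s), (X_witness e).
  by split=> //; [apply: S_witness_form | apply: X_witness_forms].
have [triv triv1] := trivial_rep.
case: t t' => [[s e]|] [[s' e']|] //= tt'.
- have [beta bSX] := std_rep s e; have [beta' bSX'] := std_rep s' e'.
  have /tt'/(witness_type ij o0 bSX)[<- ss'] := std_type _ _ _ bSX.
  have /tt'/(witness_type ij o0 bSX')[_ s's] := std_type _ _ _ bSX'.
  by congr (Some (_, _)); case: ss' s's => [|->] // [|].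
- by have /tt'/(trivial_not_form i o0 triv1) := of_type_equiv triv1.
- by have /tt'/(trivial_not_form i o0 triv1) := of_type_equiv triv1.
Qed.

(** The type is read off from the blocks of the representation itself. *)
Lemma classification (i j : 'I_n.-1) (o : 'I_k) (beta : rep) :
    j = i.+1 :> nat -> o = 0%N :> nat -> homogeneous_2local beta ->
  exists t : rep_type k, of_type t beta.
Proof.
move=> ij o0 [S [X bSX]].
have {}bSX : is_of_form beta S (fun a => X a) := bSX.
have [Xo|Xo] := eqVneq (X o : 'M_2) 1%:M.
  have [S1 X1] := is_of_form_rho0_trivial bSX ij o0 Xo.
  exists None; split=> [p|a p]; apply: val_inj.
    by rewrite /= bSX.1 S1 E1.
  by rewrite /= bSX.2 X1 E1.
have swapX a : X a != 1%:M :> 'M_2 -> has_swap_form (X a).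
  apply: involutive_braid3; first exact: Defs.GL_unit.
    exact: (is_of_form_braidX bSX ij).
  exact: (is_of_form_square bSX i).
have [s Ss] := braid3_forms (Defs.GL_unit S) (is_of_form_braidS bSX ij).
exists (Some (s, [ffun a => X (val a) != 1%:M :> 'M_2])), S, (fun a => X a).
split=> //; split=> [p p0|a].
  by rewrite (_ : p = o) //; [apply: swapX | apply: val_inj; rewrite /= p0].
by rewrite ffunE; case: eqVneq => [->|/swapX//]; rewrite mx2_1.
Qed.

End LocalRepresentations.

(** The count is [1 + 4 * 2 ^ (k - 1)]. *)
Lemma card_rep_type k : (0 < k)%N -> #|{: rep_type k}| = (2 ^ k.+1 + 1)%N.
Proof.
move=> k0; rewrite card_option card_prod card_ffun card_bool card_sig.
have -> : #|{: S_form}| = 4%N.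
  rewrite -(card_codom (can_inj S_form_codeK)).
  rewrite (eq_card (B := predT)) ?card_prod ?card_bool // => -[[] []];
    apply/codomP.
  - by exists S_right.
  - by exists S_anti.
  - by exists S_left.
  - by exists S_id.
have -> : #|[pred a : 'I_k | (0 < a)%N]| = k.-1.
  case: k k0 => // k _.
  rewrite -[RHS](card_ord k) -(card_codom (@lift_inj _ ord0)).
  apply: eq_card => a.
  rewrite !inE; apply/idP/codomP => [a0|[b ->] //].
  by case: (unliftP ord0 a) a0 => [b ->|->] // _; exists b.
by case: k k0 => // k _; rewrite /= addn1 !expnS mulnA.
Qed.

Theorem theorem3p1 (R : realType) (n k : nat) (hn : (3 <= n)%N) (hk : (1 < k)%N) :
  (* the classification *)
  (forall beta : representation R n k, homogeneous_2local beta ->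
     exists t : rep_type k, of_type_up_to_equiv t beta) /\
  (* every admissible choice of parameters does define a representation *)
  ((forall (s : S_form) (e : X_forms k) (S : 'M[R[i]]_2) (X : 'I_k -> 'M[R[i]]_2),
      has_S_form s S -> has_X_forms e X ->
      exists beta : representation R n k, is_of_form beta S X) /\
   (exists beta : representation R n k, of_type None beta)) /\
  (* the types are 2^(k+1) + 1 in number and pairwise distinct *)
  (#|{: rep_type k}| = (2 ^ k.+1 + 1)%N /\
   forall t t' : rep_type k, t <> t' ->
     ~ (forall beta : representation R n k,
          of_type_up_to_equiv t beta <-> of_type_up_to_equiv t' beta)).
Proof.
have [lt0 lt1] : (0 < n.-1)%N /\ (1 < n.-1)%N by lia.
have ij : Ordinal lt1 = (Ordinal lt0).+1 :> nat by [].
have o0 : Ordinal (ltnW hk) = 0%N :> nat by [].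
split=> [beta /(classification ij o0)[t /of_type_equiv]|]; first by exists t.
split; first by split; [exact: form_rep | exact: trivial_rep].
split; first exact/card_rep_type/ltnW.
by move=> t t' tt' eqv; apply/tt'/(types_distinct ij o0 eqv).
Qed.
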